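(* Let $p\in\mathbb{Z}$ with $p\ge5$. If $n$ is large enough, $n\ge N(p)$, then the Weyl polynomial $W^p_{\partial(B^n\times0)}$ is not conservative: some of its roots do not belong to the imaginary axis.
   Context: $B^m$ is the closed unit ball of $\mathbb{R}^m$, and $B^n\times0=\{(x,0):x\in B^n\}\subset\mathbb{R}^{n+1}$. For any compact convex set $V\subset\mathbb{R}^{n+1}$ (possibly with empty interior), let $s_k(V)$ be the coefficients of its Steiner polynomial: $\mathrm{Vol}_{n+1}(V+tB^{n+1})=\sum_{k=0}^{n+1}s_k(V)t^k$ for $t\ge0$. The Weyl coefficients of the $n$-dimensional boundary surface $\mathscr{M}=\partial V$ are by definition $w_{2l}(\mathscr{M})=2^l\frac{\Gamma(l+\frac12+1)}{\Gamma(\frac12+1)}s_{2l+1}(V)$, $0\le l\le[n/2]$. The Weyl polynomial of index $p$ is $W_{\mathscr{M}}^{p}(t)=\sum_{l=0}^{[n/2]}\frac{2^{-l}\Gamma(\frac p2+1)}{\Gamma(\frac p2+l+1)}w_{2l}(\mathscr{M})t^{2l}$. A polynomial is conservative if all its roots are purely imaginary and simple. $N(p)$ denotes a number depending only on $p$. *)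

(* Defs.v *)
From HB Require Import structures.
From mathcomp Require Import all_boot all_order all_algebra.
From mathcomp Require Import all_classical all_reals all_analysis.
From mathcomp Require Import complex.

Set Implicit Arguments.
Unset Strict Implicit.
Unset Printing Implicit Defensive.

Import Order.TTheory GRing.Theory Num.Theory.
Import numFieldNormedType.Exports.

Local Open Scope classical_set_scope.
Local Open Scope ring_scope.
Local Open Scope complex_scope.

(* The library norm of 'rV[R]_m is the sup norm, hence this definition. *)
Definition enorm (R : realType) (m : nat) (x : 'rV[R]_m) : R :=
  Num.sqrt (\sum_(i < m) x ord0 i ^+ 2).

Definition eball (R : realType) (m : nat) : set 'rV[R]_m :=
  [set x | enorm x <= 1].
Arguments eball : clear implicits.

(* The m-dimensional Lebesgue measure, as the m-fold product of the Lebesgue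
   measure of R: the product of m1 and m2 maps A to the integral with respect
   to m1 of the m2-measures of the sections of A. It is meant for measurable
   (here, compact) sets. *)
Fixpoint volume (R : realType) (m : nat) : set 'rV[R]_m -> \bar R :=
  match m with
  | 0 => fun A => (\1_A (0 : 'rV[R]_0))%:E
  | k.+1 => fun A =>
      (\int[lebesgue_measure]_x
         volume [set v : 'rV[R]_k | A (row_mx (x%:M : 'rV[R]_1) v)])%E
  end.

(* V + t B, where B is the closed unit ball *)
Definition parallel_body (R : realType) (m : nat) (V : set 'rV[R]_m) (t : R) :
    set 'rV[R]_m :=
  [set v + t *: b | v in V & b in eball R m].

Definition is_steiner_poly (R : realType) (m : nat) (V : set 'rV[R]_m)
    (S : {poly R}) : Prop :=
  (size S <= m.+1)%N /\
  forall t : R, 0 <= t -> volume (parallel_body V t) = (S.[t])%:E.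

(* By Steiner's theorem such a polynomial exists when V is nonempty, compact
   and convex; it is unique because its values at all t >= 0 are prescribed.
   The default value 0 is irrelevant for such V. *)
Definition steiner_poly (R : realType) (m : nat) (V : set 'rV[R]_m) : {poly R} :=
  xget 0 [set S | is_steiner_poly V S].

Definition Gamma (R : realType) (x : R) : R :=
  \int[lebesgue_measure]_(t in `]0, +oo[) (t `^ (x - 1) * expR (- t)).

(* weyl_coef V l is w_{2l} of the boundary surface of V *)
Definition weyl_coef (R : realType) (n : nat) (V : set 'rV[R]_n.+1) (l : nat) : R :=
  2 ^+ l * (Gamma (l%:R + 2^-1 + 1) / Gamma (2^-1 + 1 : R)) *
  (steiner_poly V)`_(2 * l + 1).

(* weyl_poly p V is W^p of the boundary surface of V *)
Definition weyl_poly (R : realType) (n : nat) (p : int) (V : set 'rV[R]_n.+1) :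
    {poly R} :=
  \sum_(l < (n./2).+1)
    (2 ^- l * Gamma (p%:~R / 2 + 1 : R) / Gamma (p%:~R / 2 + l%:R + 1) *
     weyl_coef V l) *: 'X^(2 * l).

(* B^n x 0, the n-dimensional unit ball seen as a degenerate convex set in
   R^(n+1) *)
Definition flat_ball (R : realType) (n : nat) : set 'rV[R]_n.+1 :=
  [set castmx (erefl 1%N, addn1 n) (row_mx x (0 : 'rV[R]_1)) | x in eball R n].
Arguments flat_ball : clear implicits.

Definition complex_poly (R : realType) (P : {poly R}) : {poly R[i]} :=
  map_poly (real_complex R) P.

Definition conservative (R : realType) (P : {poly R}) : Prop :=
  forall z : R[i], root (complex_poly P) z ->
    complex.Re z = 0 /\ mup z (complex_poly P) = 1%N.

(* Main.v *)
(** The parallel body of [B^n x 0] is a body of revolution, so by Tonelli its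
    volume is [\int (vol B^n) (1 + sqrt (t^2 - y^2))^n dy] over [|y| <= t].  The
    coefficients of odd degree are [vol B^n * C(n, 2l) * \int_(-1)^1 (1 - y^2)^l dy],
    and the Gamma factors turn the Weyl polynomial into a multiple of [P_n(t^2)],
    where [P_n = \sum_l l! / (p/2 + 1)_l * C(n, 2l) X^l].

    If all roots of the Weyl polynomial were imaginary, [P_n] would have only
    negative roots [-1 / v_j].  This property is preserved by the operator
    [1 + (2/p) X d/dX], which lowers [p] by 2, so it suffices to treat [p = 5, 6].
    The coefficients of [P_n(c X / n^2)] converge as [n -> oo]; by Newton's
    identities so do the power sums of the rescaled [v_j], and the inequalities
    [\sum_j v_j^m q(v_j)^2 >= 0] survive in the limit.  For [p = 5, 6] an explicit
    polynomial [q] violates one of them. *)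

From Stdlib Require Import ZArith.
Require Import Defs.
From mathcomp Require Import all_boot all_order all_algebra.
From mathcomp Require Import all_classical all_reals all_analysis.
From mathcomp Require Import measurable_realfun complex.
From mathcomp Require Import ring lra zify ssrZ.

Set Implicit Arguments.
Unset Strict Implicit.
Unset Printing Implicit Defensive.

Import Order.TTheory GRing.Theory Num.Theory.
Import numFieldNormedType.Exports.

Local Open Scope classical_set_scope.
Local Open Scope ring_scope.
Local Open Scope complex_scope.

(** * Polynomials with negative roots *)

(** The entries of [v] are the negated inverses of the roots, so the coefficients are the elementary
    symmetric functions of [v]; an entry 0 contributes the factor 1. *)
Definition neg_rooted (R : realType) (P : {poly R}) : Prop :=
  exists2 v : seq R, all (Num.le 0) v & P = \prod_(a <- v) (1 + a *: 'X).

Lemma root_complex_poly (R : realType) (P : {poly R}) (x : R) :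
  root (complex_poly P) x%:C = root P x.
Proof. exact: fmorph_root. Qed.

Lemma neg_rooted_of_roots (R : realType) (P : {poly R}) :
  P`_0 = 1 ->
  (forall z : R[i], root (complex_poly P) z ->
     complex.Im z = 0 /\ complex.Re z <= 0) ->
  neg_rooted P.
Proof.
have [m] := ubnP (size P); elim: m P => [//|m IH] P Pm P0 Pr.
have [P1|P1] := leqP (size P) 1.
  exists [::] => //; rewrite big_nil.
  by rewrite (size1_polyC P1) P0.
have /closed_rootP [z rz] : size (complex_poly P) != 1%N.
  by rewrite size_map_poly gtn_eqF.
have [zI zR] := Pr _ rz.
have zE : z = (complex.Re z)%:C by case: z zI {rz zR} => a b /= ->.
set x := complex.Re z in zE zR.
move: rz; rewrite zE root_complex_poly => rx.
have x0 : x != 0.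
  apply: contraTneq rx => ->.
  by rewrite /root horner_coef0 P0 oner_eq0.
have /factor_theorem [Q PQ] := rx.
(* Scaling the factor [X - x] to constant term 1 leaves a cofactor with constant term 1, as the
   induction requires. *)
have PQ' : P = (1 + (- x^-1) *: 'X) * ((- x) *: Q).
  rewrite PQ -scalerAr scalerAl mulrC; congr (_ * _).
  rewrite scalerDr scalerA mulrNN mulfV // scale1r scaleNr addrC.
  by rewrite -mul_polyC mulr1.
have Q0 : ((- x) *: Q)`_0 = 1.
  by move: P0; rewrite PQ' mulrDl mul1r -scalerAl coefD [X in _ + X]coefZ coefXM mulr0 addr0.
have Qn0 : Q != 0 by apply: contra_eqN Q0 => /eqP->; rewrite scaler0 coef0 eq_sym oner_eq0.
have [||v v0 Qv] := IH ((- x) *: Q) _ Q0.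
- rewrite size_scale ?oppr_eq0 //; move: Pm; rewrite PQ size_Mmonic ?monicXsubC //.
  by rewrite size_XsubC addn2 ltnS.
- move=> w rw; apply: Pr; rewrite PQ' /complex_poly rmorphM /=.
  by rewrite rootM rw orbT.
exists (- x^-1 :: v); last by rewrite big_cons -Qv.
by rewrite /= v0 andbT oppr_ge0 invr_le0.
Qed.

Lemma neg_rooted_coef0 (R : realType) (P : {poly R}) : neg_rooted P -> P`_0 = 1.
Proof.
move=> [v _ ->]; rewrite -horner_coef0 horner_prod.
by apply: big1 => a _; rewrite !hornerE.
Qed.

Lemma root_prod_linear (R : realType) (v : seq R) (z : R[i]) :
  all (Num.le 0) v ->
  root (complex_poly (\prod_(a <- v) (1 + a *: 'X))) z ->
  complex.Im z = 0 /\ complex.Re z <= 0.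
Proof.
elim: v => [|a v IH] /=; first by rewrite big_nil /complex_poly rmorph1 (negbTE (root1 _)).
move=> /andP[a0 v0]; rewrite big_cons /complex_poly rmorphM /= rootM.
move=> /orP[|/(IH v0) //].
rewrite rmorphD rmorph1 /= map_polyZ /= map_polyX /root !hornerE.
case: z {IH} => x y /=; rewrite eq_complex /= => /andP[/eqP xE /eqP yE].
have ap : 0 < a.
  rewrite lt_neqAle a0 andbT; apply/eqP => aE; move: xE; rewrite -aE; lra.
have y0 : y = 0.
  have /eqP : a * y = 0 by lra.
  by rewrite mulf_eq0 gt_eqF //= => /eqP.
split=> //; rewrite -(ler_pM2l ap); lra.
Qed.

(** Here [d] is the squared modulus of [1 + a z]. Only its positivity matters: for [a >= 0] the
    signs can be read off the numerators. *)
Lemma Im_mobius (R : realType) (a x y : R) : 1 + a%:C * (x +i* y) != 0 ->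
  exists2 d : R, 0 < d &
    a%:C * (x +i* y) / (1 + a%:C * (x +i* y)) =
    ((a * x * (1 + a * x) + (a * y) ^+ 2) / d) +i* (a * y / d).
Proof.
move=> nz.
exists ((1 + a * x) ^+ 2 + (a * y) ^+ 2).
  rewrite lt_neqAle addr_ge0 ?sqr_ge0 // andbT eq_sym paddr_eq0 ?sqr_ge0 //.
  rewrite !sqrf_eq0; apply: contra nz => /andP[/eqP h1 /eqP h2].
  by rewrite eq_complex /=; apply/andP; split; apply/eqP; lra.
apply/eqP; rewrite eq_complex /=; apply/andP; split; apply/eqP;
  rewrite !(mul0r, subr0, addr0, add0r); ring.
Qed.

Lemma log_deriv_prod_linear (R : realType) (v : seq R) (z : R[i]) :
  let P := \prod_(a <- v) (1 + a *: 'X) in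
  (complex_poly P).[z] != 0 ->
  (complex_poly P^`()).[z] =
  (complex_poly P).[z] * \sum_(a <- v) (a%:C / (1 + a%:C * z)).
Proof.
elim: v => [|a v IH] /=.
  by rewrite !big_nil derivC /complex_poly rmorph0 hornerE mulr0.
rewrite !big_cons derivM derivD derivZ derivX derivC add0r /complex_poly.
rewrite !(rmorphD, rmorphM) /= !map_polyZ /= map_polyX !rmorph1 -!/(complex_poly _).
rewrite !hornerE mulf_eq0 negb_or => /andP[nz /IH] /= ->.
by field.
Qed.

(* At a nonreal [z] every term of [z P'(z) / P(z) = \sum_j v_j z / (1 + v_j z)]
   has an imaginary part of the sign of [Im z]. *)
Lemma neg_rooted_theta (R : realType) (c : R) (P : {poly R}) : 0 < c ->
  neg_rooted P -> neg_rooted (P + c^-1 *: ('X * P^`())).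
Proof.
move=> c0 NP; apply: neg_rooted_of_roots.
  by rewrite coefD coefZ coefXM mulr0 addr0 neg_rooted_coef0.
move: NP => [v v0 ->] z rz.
set P0 := \prod_(a <- v) _ in rz.
have [/(root_prod_linear v0) //|Pz] := boolP (root (complex_poly P0) z).
(* Multiply the equation for the root [z] by [c] and divide by the nonzero value of [P0] at [z]. *)
have H : c%:C + \sum_(a <- v) (a%:C * z / (1 + a%:C * z)) = 0.
  move: rz; rewrite /root /complex_poly rmorphD /= map_polyZ rmorphM /= map_polyX.
  rewrite hornerD hornerZ hornerM hornerX log_deriv_prod_linear // => /eqP rz.
  have cc : c%:C * c^-1%:C = 1 by rewrite -rmorphM /= mulfV ?gt_eqF.
  have : (complex_poly P0).[z] * (c%:C + \sum_(a <- v) (a%:C * z / (1 + a%:C * z))) = 0.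
    have -> : \sum_(a <- v) (a%:C * z / (1 + a%:C * z)) =
        z * \sum_(a <- v) (a%:C / (1 + a%:C * z)).
      by rewrite mulr_sumr; apply: eq_bigr => a _; rewrite mulrA [z * _]mulrC.
    transitivity (c%:C * 0 : R[i]); last by rewrite mulr0.
    rewrite -[in RHS]rz [in RHS]mulrDr [c%:C * (_ * _)]mulrA cc mul1r -/(complex_poly _) -/P0.
    by ring.
  by move/eqP; rewrite mulf_eq0 -rootE (negbTE Pz) => /eqP.
have nz a : a \in v -> 1 + a%:C * z != 0.
  move=> av; apply: contra Pz => az; rewrite /P0 (big_rem a) //=.
  rewrite /complex_poly rmorphM rootM rmorphD rmorph1 /= map_polyZ map_polyX.
  by rewrite /root !hornerE az.
case: z {rz Pz} H nz => x y H nz /=.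
pose w a := a%:C * (x +i* y) / (1 + a%:C * (x +i* y)).
have HI : \sum_(a <- v) complex.Im (w a) = 0.
  by move: (congr1 (@complex.Im R) H); rewrite raddfD raddf_sum [X in X + _]/= add0r.
have HR : \sum_(a <- v) complex.Re (w a) = - c.
  move: (congr1 (@complex.Re R) H); rewrite raddfD raddf_sum [X in X + _]/=.
  by move/(canRL (addKr _)) ->; rewrite addr0.
have wE a : a \in v -> exists2 d : R, 0 < d &
    w a = ((a * x * (1 + a * x) + (a * y) ^+ 2) / d) +i* (a * y / d).
  by move=> /nz /Im_mobius.
have v0' a : a \in v -> 0 <= a by move/(allP v0).
have [y0|yn] := eqVneq y 0.
  (* At a positive real [z] every summand would be nonnegative, while their sum is [- c < 0]. *)
  split=> //; rewrite leNgt; apply/negP => x0.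
  suff : 0 <= - c by lra.
  rewrite -HR big_seq; apply: sumr_ge0 => a av.
  have [d d0 ->] := wE _ av; have a0 := v0' _ av.
  rewrite /= divr_ge0 ?(ltW d0) //.
  by rewrite addr_ge0 ?sqr_ge0 // !(mulr_ge0, addr_ge0) // ltW.
exfalso.
(* The products of [y] with the imaginary parts are nonnegative and add up to 0, so every [a]
   vanishes; then the real parts cannot add up to [- c]. *)
have H0 a : a \in v -> a = 0.
  move=> av.
  have : \sum_(b <- v) y * complex.Im (w b) = 0.
    by rewrite -mulr_sumr HI mulr0.
  move/eqP; rewrite big_seq psumr_eq0; last first.
    move=> b bv; have [d d0 ->] := wE _ bv.
    rewrite /= (_ : y * (b * y / d) = b * y ^+ 2 / d); last by ring.
    by apply: divr_ge0 (ltW d0); apply: mulr_ge0 (sqr_ge0 _); exact: v0'.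
  move=> /allP /(_ _ av) /implyP /(_ av).
  have [d d0 ->] := wE _ av; rewrite /= !mulf_eq0 (negbTE yn) /=.
  by rewrite invr_eq0 orbF (gt_eqF d0) orbF => /eqP.
move: HR; rewrite big_seq big1 => [|a /H0 ->]; last by rewrite /w !mul0r.
lra.
Qed.

(** * Newton's identities and limits of power sums *)

Definition power_sum (R : realType) (v : seq R) (k : nat) : R := \sum_(a <- v) a ^+ k.

Lemma geometric_poly (R : realType) (a : R) (m : nat) :
  (1 + a *: 'X) * (\sum_(k < m) ((-1) ^+ k * a ^+ k.+1) *: 'X^k) =
  a%:P - (a * (- a) ^+ m) *: 'X^m :> {poly R}.
Proof.
have -> : \sum_(k < m) ((-1) ^+ k * a ^+ k.+1) *: 'X^k =
    a *: \sum_(k < m) (- a *: 'X) ^+ k :> {poly R}.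
  rewrite scaler_sumr; apply: eq_bigr => k _.
  by rewrite exprZn scalerA -[- a]mulN1r exprMn exprS mulrCA.
rewrite -scalerAr.
have -> : 1 + a *: 'X = - ((- a *: 'X) - 1) :> {poly R}.
  by rewrite opprB scaleNr opprK.
rewrite mulNr -subrX1 opprB exprZn scalerBr scalerA.
by rewrite -mul_polyC mulr1.
Qed.

(** Expand each term of [P' / P = \sum_a a / (1 + a X)] into a geometric series. Multiplied by [P]
    and with the remainder kept as a multiple of [X^m], this is an identity of polynomials. *)
Lemma deriv_prod_power_sum (R : realType) (v : seq R) (m : nat) :
  let P := \prod_(a <- v) (1 + a *: 'X) in
  exists Q : {poly R},
    P^`() = P * (\sum_(k < m) ((-1) ^+ k * power_sum v k.+1) *: 'X^k) + 'X^m * Q.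
Proof.
elim: v => [|a v [Q IH]] /=.
  exists 0; rewrite big_nil derivC mulr0 addr0 mul1r big1 // => k _.
  by rewrite /power_sum big_nil mulr0 scale0r.
rewrite big_cons; set P := \prod_(a <- v) _ in IH *.
exists ((1 + a *: 'X) * Q + (a * (- a) ^+ m) *: P).
rewrite derivM derivD derivZ derivX derivC add0r IH.
under [X in _ = _ * X + _]eq_bigr => k _.
  rewrite /power_sum big_cons mulrDr scalerDl -/(power_sum v k.+1).
  over.
rewrite big_split /=; set G := \sum_(k < m) (_ * a ^+ _) *: _; set T := \sum_(k < m) _.
have -> : (1 + a *: 'X) * P * (G + T) = P * ((1 + a *: 'X) * G) + (1 + a *: 'X) * P * T.
  by ring.
by rewrite geometric_poly -mul_polyC mulr1 -!mul_polyC; ring.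
Qed.

Lemma newton_identity (R : realType) (v : seq R) (l : nat) :
  let P := \prod_(a <- v) (1 + a *: 'X) in
  l.+1%:R * P`_l.+1 = \sum_(k < l.+1) (-1) ^+ k * power_sum v k.+1 * P`_(l - k).
Proof.
move=> P; have [Q /(congr1 (fun p : {poly R} => p`_l))] := deriv_prod_power_sum v l.+1.
rewrite coef_deriv coefD coefXnM ltnSn addr0 -/P mulr_natl => ->.
rewrite mulrC coefM; apply: eq_bigr => k _; congr (_ * _).
rewrite coef_sum (bigD1 k) //= coefZ coefXn eqxx mulr1 big1 ?addr0 // => i ik.
by rewrite coefZ coefXn (inj_eq val_inj) eq_sym (negbTE ik) mulr0.
Qed.

(** The double sum is [\sum_a a^m q(a)^2], where [q] is read as a list of coefficients. *)
Lemma power_sum_form_ge0 (R : realType) (v q : seq R) (m : nat) :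
  all (Num.le 0) v ->
  0 <= \sum_(i < size q) \sum_(j < size q) q`_i * q`_j * power_sum v (m + i + j).
Proof.
move=> v0.
have -> : \sum_(i < size q) \sum_(j < size q) q`_i * q`_j * power_sum v (m + i + j) =
    \sum_(a <- v) a ^+ m * (\sum_(i < size q) q`_i * a ^+ i) ^+ 2.
  symmetry; under eq_bigr => a _ do rewrite expr2 big_distrlr /= mulr_sumr.
  rewrite exchange_big; apply: eq_bigr => i _.
  under eq_bigr => a _ do rewrite mulr_sumr.
  rewrite exchange_big; apply: eq_bigr => j _.
  by rewrite mulr_sumr; apply: eq_bigr => a _; rewrite !exprD; ring.
rewrite big_seq; apply: sumr_ge0 => a av.
by rewrite mulr_ge0 ?sqr_ge0 // exprn_ge0 // (allP v0).
Qed.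

(** As the constant coefficient is 1, Newton's identities express each power sum through
    coefficients and earlier power sums, so convergence passes to the power sums by strong
    induction. [s k] is the limit for exponent [k + 1]; exponent 0 would count the entries of [v n],
    which may grow without bound. *)
Lemma power_sum_limit (R : realType) (v : nat -> seq R) (a : nat -> R) :
  (forall n, all (Num.le 0) (v n)) ->
  (forall l, (\prod_(b <- v n) (1 + b *: 'X))`_l @[n --> \oo] --> a l) ->
  exists s : nat -> R,
    (forall l, l.+1%:R * a l.+1 = \sum_(k < l.+1) (-1) ^+ k * s k * a (l - k)%N) /\
    (forall (m : nat) (q : seq R),
      0 <= \sum_(i < size q) \sum_(j < size q) q`_i * q`_j * s (m + i + j)%N).
Proof.
move=> v0 va.
pose e n l := (\prod_(b <- v n) (1 + b *: 'X))`_l.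
have e0 n : e n 0%N = 1 by apply: neg_rooted_coef0; exists (v n).
have cs k : cvgn (fun n => power_sum (v n) k.+1).
  elim/ltn_ind: k => k IH.
  have -> : (fun n => power_sum (v n) k.+1) = (fun n => (-1) ^+ k *
     (k.+1%:R * e n k.+1 - \sum_(i < k) (-1) ^+ i * power_sum (v n) i.+1 * e n (k - i)%N)).
    apply/funext => n; rewrite /e newton_identity big_ord_recr /= subnn -/(e n 0%N) e0.
    by rewrite mulr1 [X in _ * (X - _)]addrC addrK mulrA -expr2 sqrr_sign mul1r.
  apply: is_cvgMr; apply: is_cvgB.
    by apply: is_cvgMr; apply/cvg_ex; exists (a k.+1); exact: va.
  apply/cvg_ex; eexists; apply: cvg_big => [|i _]; first exact: add_continuous.
  by apply: cvgM; [apply: cvgMr; exact: IH | exact: va].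
exists (fun k => limn (fun n => power_sum (v n) k.+1)); split.
  move=> l.
  have h1 : l.+1%:R * e n l.+1 @[n --> \oo] --> l.+1%:R * a l.+1.
    by apply: cvgMr; exact: va.
  have h2 : l.+1%:R * e n l.+1 @[n --> \oo] -->
      \sum_(k < l.+1) (-1) ^+ k * limn (fun n => power_sum (v n) k.+1) * a (l - k)%N.
    under eq_fun do rewrite /e newton_identity.
    apply: cvg_big => [|k _]; first exact: add_continuous.
    apply: cvgM; last exact: va.
    by apply: cvgMr; exact: cs.
  exact: (cvg_unique _ h1 h2).
move=> m q.
have h : \sum_(i < size q) \sum_(j < size q)
      q`_i * q`_j * power_sum (v n) (m.+1 + i + j)%N @[n --> \oo] -->
    \sum_(i < size q) \sum_(j < size q) q`_i * q`_j * limn (fun n => power_sum (v n) (m + i + j).+1).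
  apply: cvg_big => [|i _]; first exact: add_continuous.
  apply: cvg_big => [|j _]; first exact: add_continuous.
  apply: cvgMr.
  by rewrite !addSn; exact: cs.
apply: (cvgr_to_ge h); near=> n; exact: power_sum_form_ge0.
Unshelve. all: by end_near. Qed.

(** * The limit coefficients for p = 5 and p = 6 *)

(** A sum that [vm_compute] can evaluate, unlike the locked big operators. *)
Definition Zsum (n : nat) (F : nat -> Z) : Z := foldr (fun k x => F k + x) 0 (iota 0 n).

Lemma ZsumE (n : nat) (F : nat -> Z) : Zsum n F = \sum_(k < n) F k.
Proof. by rewrite -(big_mkord xpredT) unlock /index_iota subn0. Qed.

(* The quotient is exact for the instances below, which [certificate] checks. *)
Fixpoint limit_coefs (p : nat) (c : Z) (n : nat) : seq Z :=
  if n is m.+1 then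
    let A := limit_coefs p c m in
    rcons A (Z.div (c * A`_m) (m.*2.+1%:R * (m.*2 + p + 2)%:R))
  else [:: 1].

(** Newton's identities solved for the newest power sum. [certificate] checks the identities again,
    so the recursion itself needs no correctness proof. *)
Fixpoint newton_sums (A : seq Z) (n : nat) : seq Z :=
  if n is m.+1 then
    let S := newton_sums A m in
    rcons S ((-1) ^+ m * (m.+1%:R * A`_m.+1 - Zsum m (fun k => (-1) ^+ k * S`_k * A`_(m - k))))
  else [::].

(* [S`_k] is the power sum of exponent [k + 1], so the last conjunct says that
   [\sum_j v_j^(m+1) q(v_j)^2] is negative. *)
Definition certificate (p : nat) (c : Z) (n m : nat) (q : seq Z) : bool :=
  let A := limit_coefs p c n in
  let S := newton_sums A n in
  [&& all (fun l => l.*2.+1%:R * (l.*2 + p + 2)%:R * A`_l.+1 == c * A`_l) (iota 0 n),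
      all (fun l => l.+1%:R * A`_l.+1 ==
                    Zsum l.+1 (fun k => (-1) ^+ k * S`_k * A`_(l - k))) (iota 0 n),
      (m + (size q).*2 <= n.+1)%N
    & Zsum (size q) (fun i => Zsum (size q) (fun j => q`_i * q`_j * S`_(m + i + j))) < 0].

(* [8 * 9 * 5 * 7 * 11 * 13 * 17 * 19 * 23 * 29 * 31]: rescaling the variable by it
   makes the limit coefficients that are used here integers. *)
Definition scale : Z := 2406725881560.

Section Certificates.
Local Open Scope Z_scope.

(* With normalized leading coefficient, each [q] is a rounded minimizer of the smallest
   Hankel form that is not positive. *)
Lemma certificate_5 : certificate 5 scale 14 1
  [:: 4 * scale ^ 6; -960 * 16 * scale ^ 5; 52305 * 16 ^ 2 * scale ^ 4;
      -996011 * 16 ^ 3 * scale ^ 3; 7341630 * 16 ^ 4 * scale ^ 2;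
      -19863343 * 16 ^ 5 * scale; 9951105 * 16 ^ 6].
Proof. by vm_compute. Qed.

Lemma certificate_6 : certificate 6 scale 7 2
  [:: scale ^ 2; -133 * scale; 1439].
Proof. by vm_compute. Qed.

End Certificates.

(** The two recurrences determine [a] and [s] from [a 0 = 1], so [f] maps the computed integers to
    them; the negative integer form then becomes a negative real form. *)
Lemma certificate_sound (R : realType) (f : {rmorphism Z -> R}) (p : nat) (c : Z)
    (n m : nat) (q : seq Z) (a s : nat -> R) :
  (forall x : Z, x < 0 -> f x < 0) ->
  certificate p c n m q ->
  a 0%N = 1 -> (forall l, l.*2.+1%:R * (l.*2 + p + 2)%:R * a l.+1 = f c * a l) ->
  (forall l, l.+1%:R * a l.+1 = \sum_(k < l.+1) (-1) ^+ k * s k * a (l - k)%N) ->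
  ~ (forall (k : nat) (r : seq R),
      0 <= \sum_(i < size r) \sum_(j < size r) r`_i * r`_j * s (k + i + j)%N).
Proof.
move=> f0 + a0 ha hs hq; rewrite /certificate.
have A0 : (limit_coefs p c n)`_0 = 1.
  have As j : size (limit_coefs p c j) = j.+1 by elim: j => //= j; rewrite size_rcons => ->.
  by elim: n => //= j IH; rewrite nth_rcons As.
move: (limit_coefs p c n) A0 => A A0; move: (newton_sums A n) => S.
move=> /and4P[/allP /= hA /allP /= hS mn].
have fA l : (l <= n)%N -> f A`_l = a l.
  elim: l => [_|l IH ln]; first by rewrite A0 rmorph1 a0.
  have D0 : l.*2.+1%:R * (l.*2 + p + 2)%:R != 0 :> R.
    by rewrite mulf_neq0 ?pnatr_eq0 // addn2.
  apply: (mulfI D0); rewrite ha -IH ?(ltnW ln) //.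
  have /hA /eqP /(congr1 f) : l \in iota 0 n by rewrite mem_iota.
  by rewrite !rmorphM /= !rmorph_nat => <-.
have fS l : (l < n)%N -> f S`_l = s l.
  elim/ltn_ind: l => l IH ln.
  have /hS /eqP /(congr1 f) : l \in iota 0 n by rewrite mem_iota.
  rewrite ZsumE rmorphM rmorph_nat fA // hs rmorph_sum !big_ord_recr /= subnn.
  rewrite a0 A0 !mulr1 rmorphM rmorphXn rmorphN1.
  have -> : \sum_(i < l) f ((-1) ^+ i * S`_i * A`_(l - i)) =
            \sum_(i < l) (-1) ^+ i * s i * a (l - i)%N.
    apply: eq_bigr => i _; rewrite !rmorphM rmorphXn rmorphN1 IH ?(ltn_trans _ ln) //.
    by rewrite fA // (leq_trans (leq_subr _ _)) // ltnW.
  by move/addrI/(can_inj (signrMK _)).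
rewrite ZsumE; under eq_bigr do rewrite ZsumE.
move/f0; apply/negP; rewrite -leNgt.
have := hq m (map f q); rewrite size_map => /le_trans; apply.
rewrite rmorph_sum le_eqVlt; apply/orP; left; apply/eqP.
apply: eq_bigr => i _; rewrite rmorph_sum; apply: eq_bigr => j _.
rewrite !rmorphM /= !(nth_map 0) // fS //.
(* The size condition in [certificate] gives [m + i + j < n], so only verified power sums occur. *)
have := ltn_ord i; have := ltn_ord j; move: mn; rewrite -muln2.
move: (nat_of_ord i) (nat_of_ord j) => x y; clear; move: (size q) => z; lia.
Qed.

Lemma no_neg_rooted_limit (R : realType) (p : nat) (P : nat -> {poly R}) (a : nat -> R) :
  p = 5%N \/ p = 6%N ->
  (forall n, neg_rooted (P n)) ->
  (forall l, (P n)`_l @[n --> \oo] --> a l) ->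
  ~ (forall l, l.*2.+1%:R * (l.*2 + p + 2)%:R * a l.+1 = (int_of_Z scale)%:~R * a l).
Proof.
move=> p56 NP Pa ha.
have [v vP] : {v : nat -> seq R & forall n, all (Num.le 0) (v n) /\
    P n = \prod_(b <- v n) (1 + b *: 'X)}.
  apply: (@boolp.choice _ _ (fun n v => all (Num.le 0) v /\
    P n = \prod_(b <- v) (1 + b *: 'X))) => n.
  by have [v] := NP n; exists v.
have [||s [hs hq]] := @power_sum_limit R v a.
- by move=> n; case: (vP n).
- move=> l; have -> : (fun n => (\prod_(b <- v n) (1 + b *: 'X))`_l) = (fun n => (P n)`_l).
    by apply/funext => n; case: (vP n) => _ ->.
  exact: Pa.
have a0 : a 0%N = 1.
  apply: (cvg_unique _ (Pa 0%N)) => //.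
  have -> : (fun n => (P n)`_0) = (fun=> 1); last exact: cvg_cst.
  by apply/funext => n; exact: neg_rooted_coef0.
pose f : {rmorphism Z -> R} := intr \o int_of_Z.
have f0 (x : Z) : x < 0 -> f x < 0 by rewrite /= ltrz0; lia.
case: p56 ha => -> ha.
- exact: (certificate_sound f0 certificate_5 a0 ha hs hq).
- exact: (certificate_sound f0 certificate_6 a0 ha hs hq).
Qed.

(** * The normalized Weyl polynomials *)

Lemma neg_rooted_scale (R : realType) (c : R) (P : {poly R}) : 0 <= c ->
  neg_rooted P -> exists2 Q, neg_rooted Q & forall l, Q`_l = c ^+ l * P`_l.
Proof.
move=> c0 [v v0 ->]; exists (\prod_(a <- [seq c * a | a <- v]) (1 + a *: 'X)).
  exists [seq c * a | a <- v] => //.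
  by rewrite all_map; apply: sub_all v0 => a /= a0; exact: mulr_ge0.
rewrite big_map.
elim: v v0 => [_|a v IH /= /andP[_ /IH {}IH]] l.
  by rewrite !big_nil !coef1; case: l => [|l]; rewrite ?mul1r ?mulr0.
rewrite !big_cons !mulrDl !mul1r -!scalerAl !coefD !coefZ !coefXM IH.
case: l => [|l] /=; first by rewrite !mulr0 !addr0.
by rewrite IH exprS; ring.
Qed.

Definition weyl_ratio (R : realType) (p l : nat) : R :=
  \prod_(i < l) (i.+1%:R / (p%:R / 2 + 1 + i%:R)).

Definition weyl_ball (R : realType) (p n : nat) : {poly R} :=
  \sum_(l < (n./2).+1) (weyl_ratio R p l * 'C(n, 2 * l)%:R) *: 'X^l.

(** The summation bound disappears because the binomial coefficient is 0 for [2 l > n]. *)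
Lemma coef_weyl_ball (R : realType) (p n l : nat) :
  (weyl_ball R p n)`_l = weyl_ratio R p l * 'C(n, 2 * l)%:R.
Proof.
rewrite /weyl_ball -(poly_def _ (fun l => weyl_ratio R p l * 'C(n, 2 * l)%:R)).
rewrite coef_poly; case: ltnP => // nl.
by rewrite bin_small ?mulr0 //; move: nl; lia.
Qed.

Lemma weyl_ratioS (R : realType) (p l : nat) :
  weyl_ratio R p l.+1 = weyl_ratio R p l * (l.+1%:R / (p%:R / 2 + 1 + l%:R)).
Proof. exact: big_ord_recr. Qed.

Lemma weyl_ratioD2 (R : realType) (p l : nat) :
  weyl_ratio R p.+2 l * (p%:R / 2 + 1 + l%:R) = (p%:R / 2 + 1) * weyl_ratio R p l.
Proof.
elim: l => [|l IH]; first by rewrite /weyl_ratio !big_ord0; ring.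
rewrite !weyl_ratioS [RHS]mulrA -IH.
have h : p%:R / 2 + 1 + l%:R != 0 :> R by rewrite gt_eqF // !(ltr_wpDr, ltr_wpDl).
have h' : p%:R / 2 + 1 + 1 + l%:R != 0 :> R by rewrite gt_eqF // !(ltr_wpDr, ltr_wpDl).
have -> : p.+2%:R / 2 + 1 + l%:R = p%:R / 2 + 1 + 1 + l%:R :> R.
  by rewrite -addn2 natrD; field.
rewrite -[l.+1 in X in _ * X = _]addn1 natrD.
by field; apply/andP; split.
Qed.

(** With [c = p/2 + 1], the operator [1 + c^-1 X d/dX] multiplies the coefficient of [X^l] by
    [(c + l) / c], which by [weyl_ratioD2] turns the ratio for [p + 2] into that for [p]. *)
Lemma weyl_ball_descent (R : realType) (p n : nat) :
  neg_rooted (weyl_ball R p.+2 n) -> neg_rooted (weyl_ball R p n).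
Proof.
have c0 : 0 < p%:R / 2 + 1 :> R by rewrite ltr_wpDl.
move=> /(neg_rooted_theta c0); congr neg_rooted.
apply/polyP => l; rewrite coefD coefZ coefXM !coef_weyl_ball.
apply: (mulfI (lt0r_neq0 c0)); rewrite [RHS]mulrA -weyl_ratioD2.
case: l => [|l] /=; first by rewrite mulr0 !addr0 [LHS]mulrC [RHS]mulrAC.
rewrite coef_deriv coef_weyl_ball.
rewrite mulrDr mulVKf ?lt0r_neq0 // -mulr_natr; ring.
Qed.

Lemma weyl_ball_descent_iter (R : realType) (p n k : nat) :
  neg_rooted (weyl_ball R (p + k.*2) n) -> neg_rooted (weyl_ball R p n).
Proof.
elim: k p => [|k IH] p; first by rewrite addn0.
by rewrite doubleS !addnS => /weyl_ball_descent /IH.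
Qed.

Lemma cvg_bin_expn (R : realType) (u : nat -> nat) (k : nat) :
  (forall j, (j < u j)%N) ->
  'C(u j, k)%:R / (u j)%:R ^+ k @[j --> \oo] --> (k`!%:R^-1 : R).
Proof.
move=> hu.
have u0 j : (u j)%:R != 0 :> R by rewrite pnatr_eq0 -lt0n (leq_ltn_trans _ (hu j)).
have cu : ((u j)%:R^-1 : R) @[j --> \oo] --> 0.
  apply: (@squeeze_cvgr _ _ _ _ (fun=> 0) (@harmonic R)).
  - near=> j; rewrite invr_ge0 ler0n /= /harmonic lef_pV2 ?posrE ?ltr0n //.
      by rewrite ler_nat.
    exact: leq_ltn_trans (hu j).
  - exact: cvg_cst.
  - exact: cvg_harmonic.
elim: k => [|k IH].
  under eq_fun do rewrite bin0 expr0 divr1.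
  by rewrite fact0 invr1; exact: cvg_cst.
(* From [(k + 1) C(u, k + 1) = (u - k) C(u, k)], the normalized binomial gains the factor
   [(1 - k / u) / (k + 1)], and [1 / u j] tends to 0. *)
have -> : (fun j => 'C(u j, k.+1)%:R / (u j)%:R ^+ k.+1) =
    (fun j => 'C(u j, k)%:R / (u j)%:R ^+ k * (1 - k%:R * (u j)%:R^-1) / k.+1%:R) :> (nat -> R).
  apply/funext => j.
  have e : k.+1%:R * 'C(u j, k.+1)%:R = ((u j)%:R - k%:R) * 'C(u j, k)%:R :> R.
    have [ku|uk] := leqP k (u j).
      by rewrite -natrM mul_bin_left natrM natrB.
    by rewrite !bin_small ?mulr0 // ltnW.
  have k0 : k.+1%:R != 0 :> R by rewrite pnatr_eq0.
  apply: (mulfI k0); rewrite mulrA e exprS.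
  by field; rewrite nat1r k0 u0 expf_neq0.
have -> : k.+1`!%:R^-1 = k`!%:R^-1 * (1 - k%:R * 0) / k.+1%:R :> R.
  by rewrite mulr0 subr0 mulr1 factS natrM invfM mulrC.
apply: cvgMl; apply: cvgM => //; apply: cvgB; first exact: cvg_cst.
exact: cvgMr.
Unshelve. all: by end_near. Qed.

(** The Taylor coefficients of the hypergeometric function [1F2(1; p/2 + 1, 1/2; c x / 4)]. *)
Definition weyl_limit (R : realType) (p : nat) (c : R) (l : nat) : R :=
  c ^+ l * weyl_ratio R p l / (2 * l)`!%:R.

Lemma weyl_limit_rec (R : realType) (p : nat) (c : R) (l : nat) :
  l.*2.+1%:R * (l.*2 + p + 2)%:R * weyl_limit p c l.+1 = c * weyl_limit p c l.
Proof.
rewrite /weyl_limit exprS weyl_ratioS mulnS !addSn add0n !factS !natrM.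
have : p%:R / 2 + 1 + l%:R != 0 :> R by rewrite gt_eqF // !(ltr_wpDr, ltr_wpDl).
have : (2 * l)`!%:R != 0 :> R by rewrite pnatr_eq0 -lt0n fact_gt0.
have : (2 * l).+1%:R != 0 :> R by rewrite pnatr_eq0.
have : l.+1%:R != 0 :> R by rewrite pnatr_eq0.
have -> : (l.*2 + p + 2)%:R = 2 * (p%:R / 2 + 1 + l%:R) :> R.
  by rewrite 2!natrD -mul2n natrM; field.
have -> : (2 * l).+2%:R = 2 * l.+1%:R :> R by rewrite -natrM mulnS.
rewrite -mul2n; move: (c ^+ l) (weyl_ratio R p l) => x5 x6.
move: (p%:R / 2 + 1 + l%:R : R) ((2 * l)`!%:R : R) ((2 * l).+1%:R : R) (l.+1%:R : R).
by move=> x1 x2 x3 x4 h4 h3 h2 h1; field; rewrite h1 h2 h3 h4.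
Qed.

Lemma weyl_ball_not_neg_rooted (R : realType) (p : nat) : (5 <= p)%N ->
  exists N : nat, forall n, (N <= n)%N -> ~ neg_rooted (weyl_ball R p n).
Proof.
move=> p5; apply: contrapT => /forallNP h.
(* If no [N] works, negative-rootedness holds for arbitrarily large indices; the limit is taken
   along such indices [u j > j]. *)
have [u hu] : {u : nat -> nat & forall j, (j < u j)%N /\ neg_rooted (weyl_ball R p (u j))}.
  apply: (@boolp.choice _ _ (fun j n => (j < n)%N /\ neg_rooted (weyl_ball R p n))) => j.
  have /existsNP [n /not_implyP [jn /contrapT nr]] := h j.+1.
  by exists n.
(* The parity of [p] decides whether the descent by steps of 2 ends at 5 or at 6. *)
pose p' := (5 + ~~ odd p)%N.
have pE : p = (p' + ((p - p')./2).*2)%N by rewrite /p'; lia.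
pose c : R := (int_of_Z scale)%:~R.
have c0 : 0 <= c by rewrite ler0z.
have hQ j : exists Q : {poly R}, neg_rooted Q /\
    forall l, Q`_l = (c / (u j)%:R ^+ 2) ^+ l * (weyl_ball R p' (u j))`_l.
  have [_] := hu j; rewrite {1}pE => /weyl_ball_descent_iter nr.
  have [|Q] := @neg_rooted_scale R (c / (u j)%:R ^+ 2) _ _ nr; last by exists Q.
  by rewrite divr_ge0 // exprn_ge0.
have [Q QP] := boolp.choice hQ.
pose a := weyl_limit p' c.
apply: (@no_neg_rooted_limit R p' Q a).
- by rewrite /p'; case: odd; [left|right].
- by move=> n; case: (QP n).
- move=> l.
  have -> : (fun n => (Q n)`_l) = (fun n => c ^+ l * weyl_ratio R p' l *
       ('C(u n, 2 * l)%:R / (u n)%:R ^+ (2 * l))).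
    apply/funext => n; have [_ ->] := QP n.
    by rewrite coef_weyl_ball expr_div_n -exprM mulrCA !mulrA; ring.
  by apply: cvgMr; apply: cvg_bin_expn => j; case: (hu j).
- by move=> l; exact: weyl_limit_rec.
Qed.

Lemma complex_real_sqr (R : realType) (t : R[i]) : complex.Re t = 0 ->
  complex.Im (t ^+ 2) = 0 /\ complex.Re (t ^+ 2) <= 0.
Proof.
rewrite expr2; case: t => x y /= ->; split; first by ring.
by rewrite mul0r sub0r oppr_le0 -expr2 sqr_ge0.
Qed.

(** A root [z] of the ball polynomial yields the root [sqrtC z] of [W]. Were all roots of [W]
    imaginary, every such [z] would be real and nonpositive. *)
Lemma weyl_ball_nonreal_root (R : realType) (p n : nat) (c : R) (W : {poly R}) :
  W = c *: (weyl_ball R p n \Po 'X^2) -> ~ neg_rooted (weyl_ball R p n) ->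
  exists2 z : R[i], root (complex_poly W) z & complex.Re z <> 0.
Proof.
move=> -> nr; apply: contrapT => /forall2NP h.
apply: nr; apply: neg_rooted_of_roots.
  by rewrite coef_weyl_ball /weyl_ratio big_ord0 mul1r bin0.
move=> z rz.
have := h (sqrtC z) => -[|/contrapT].
  case; rewrite /complex_poly map_polyZ map_comp_poly map_polyXn.
  rewrite rootE hornerZ horner_comp hornerXn sqrtCK.
  by move: rz; rewrite rootE => /eqP ->; rewrite mulr0.
by move=> /complex_real_sqr; rewrite sqrtCK.
Qed.

(** * The functional equation of the Gamma function *)

Lemma continuous_powR (R : realType) (a s : R) : 0 < s -> {for s, continuous (@powR R ^~ a)}.
Proof.
move=> s0; apply: differentiable_continuous; apply/derivable1_diffP.
by apply: derivable_powR; rewrite in_itv /= s0.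
Qed.

Lemma cvg_powR_at_right0 (R : realType) (a : R) : 0 < a ->
  s `^ a @[s --> 0^'+] --> (0 : R) `^ a.
Proof. by move=> a0; rewrite powR0 ?gt_eqF //; exact: powR_cvg0. Qed.

(** The bound [1 < x] makes the integrand continuous at 0, so the fundamental theorem applies on the
    closed interval. *)
Lemma integral_powR (R : realType) (x t : R) : 1 < x -> 0 < t ->
  (\int[lebesgue_measure]_(s in `]0%R, t]) (x * s `^ (x - 1))%:E = (t `^ x)%:E)%E.
Proof.
move=> x1 t0; have x0 : 0 < x by lra.
have x10 : 0 < x - 1 by lra.
rewrite integral_itv_obnd_cbnd; last first.
  apply/measurable_EFinP; apply: measurable_funM; first exact: measurable_cst.
  by apply: measurable_funTS; exact: measurable_powR.
rewrite (@continuous_FTC2 _ _ (@powR R ^~ x)) //.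
- by rewrite powR0 ?gt_eqF // sube0.
- apply/continuous_within_itvP => //; split.
  + move=> s; rewrite in_itv /= => /andP[s0 _].
    by apply: cvgM; [exact: cvg_cst | exact: continuous_powR].
  + by apply: cvgM; [exact: cvg_cst | exact: cvg_powR_at_right0].
  + apply: cvgM; first exact: cvg_cst.
    by apply: cvg_at_left_filter; exact: continuous_powR.
- split.
  + by move=> s; rewrite in_itv /= => /andP[s0 _]; apply: derivable_powR; rewrite in_itv /= s0.
  + exact: cvg_powR_at_right0.
  + by apply: cvg_at_left_filter; exact: continuous_powR.
- by move=> s; rewrite in_itv /= => /andP[s0 _]; rewrite powR_derive1 // in_itv /= s0.
Qed.

Lemma integral_expRN (R : realType) (s : R) :
  (\int[lebesgue_measure]_(t in `[s, +oo[) (expR (- t))%:E = (expR (- s))%:E)%E.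
Proof.
have d (t : R) : is_derive t 1 (fun t => - expR (- t)) (expR (- t)).
  by apply: is_derive_eq; rewrite mulrN1 opprK.
have c : continuous (fun t : R => expR (- t)).
  move=> t; apply: (@continuous_comp _ _ _ -%R expR); first exact: continuousN.
  exact: continuous_expR.
rewrite (@ge0_continuous_FTC2y _ _ (fun t => - expR (- t)) _ 0).
- by rewrite EFinN oppeK add0e.
- by move=> t _; exact: expR_ge0.
- exact: continuous_subspaceT.
- by rewrite -oppr0; apply: cvgN; exact: cvgr_expR.
- by move=> t _; exact: ex_derive.
- by apply: cvg_at_right_filter; apply: cvgN; exact: c.
- by move=> t _; rewrite derive1E derive_val.
Qed.

(* Tonelli for the integrand [x s^(x-1) e^(-t)] on the region [0 < s <= t]. *)
Lemma Gamma_rec (R : realType) (x : R) : 1 < x -> Gamma (x + 1) = x * Gamma x.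
Proof.
move=> x1; have x0 : 0 < x by lra.
pose f (u : measurableTypeR R * measurableTypeR R) : \bar R :=
  (if (0 < u.1) && (u.1 <= u.2) then x * u.1 `^ (x - 1) * expR (- u.2) else 0)%:E.
have f0 u : (0 <= f u)%E.
  rewrite lee_fin; case: ifP => // _.
  by rewrite !mulr_ge0 ?expR_ge0 ?powR_ge0 // ltW.
have mf : measurable_fun setT f.
  apply/measurable_EFinP; apply: measurable_fun_ifT.
  - apply: measurable_and; first by apply: measurable_fun_ltr.
    by apply: measurable_fun_ler.
  - apply: measurable_funM.
      apply: measurable_funM; first exact: measurable_cst.
      exact: (measurableT_comp (measurable_powR _) measurable_fst).
    apply: measurableT_comp; first exact: measurable_expR.
    exact: measurableT_comp.
  - exact: measurable_cst.
have mexp (D : set (measurableTypeR R)) : measurable_fun D (fun t : R => (expR (- t))%:E).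
  apply/measurable_EFinP; apply: measurable_funTS.
  apply: measurableT_comp; first exact: measurable_expR.
  exact: oppr_measurable.
have mpow (D : set (measurableTypeR R)) : measurable_fun D (fun s : R => (x * s `^ (x - 1))%:E).
  apply/measurable_EFinP; apply: measurable_funTS.
  by apply: measurable_funM; [exact: measurable_cst | exact: measurable_powR].
have E1 (t : R) : (\int[lebesgue_measure]_s f (s, t) =
    ((fun t => (t `^ x * expR (- t))%:E) \_ `]0%R, +oo[) t)%E.
  rewrite patchE; transitivity (\int[lebesgue_measure]_(s in `]0%R, t])
      ((x * s `^ (x - 1))%:E * (expR (- t))%:E))%E.
    rewrite [RHS]integral_mkcond; apply: eq_integral => s _.
    by rewrite patchE mem_setE in_itv /= /f /=; case: ifP.
  rewrite mem_setE in_itv /= andbT; case: ltP => t0; last first.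
    have -> : `]0%R, t]%classic = set0 :> set R.
      by apply/seteqP; split => s //=; rewrite in_itv /= => /andP[? ?]; lra.
    exact: integral_set0.
  rewrite ge0_integralZr ?integral_powR // ?lee_fin ?expR_ge0 //.
  by move=> s _; rewrite lee_fin; apply: mulr_ge0; [exact: ltW | exact: powR_ge0].
have E2 (s : R) : (\int[lebesgue_measure]_t f (s, t) =
    ((fun s => x%:E * (s `^ (x - 1) * expR (- s))%:E) \_ `]0%R, +oo[) s)%E.
  rewrite patchE mem_setE in_itv /= andbT; case: ltP => s0; last first.
    by rewrite integral0_eq // => t _; rewrite /f /= ltNge s0.
  transitivity (\int[lebesgue_measure]_(t in `[s, +oo[)
      ((x * s `^ (x - 1))%:E * (expR (- t))%:E))%E.
    rewrite [RHS]integral_mkcond; apply: eq_integral => t _.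
    by rewrite patchE mem_setE in_itv /= /f /= s0 /= andbT; case: ifP.
  rewrite ge0_integralZl ?lee_fin ?mulr_ge0 ?powR_ge0 // ?(ltW x0) //.
  by rewrite integral_expRN -!EFinM mulrA.
have := @fubini_tonelli _ _ _ _ _ lebesgue_measure lebesgue_measure f mf f0.
under eq_integral do rewrite E2.
under [X in _ = X -> _]eq_integral do rewrite E1.
rewrite -!integral_mkcond ge0_integralZl //; last first.
- by rewrite lee_fin ltW.
- by move=> s _; rewrite lee_fin mulr_ge0 ?expR_ge0 ?powR_ge0.
- apply/measurable_EFinP; apply: measurable_funTS; apply: measurable_funM.
    exact: measurable_powR.
  apply: measurableT_comp; first exact: measurable_expR.
  exact: oppr_measurable.
rewrite /Gamma /Rintegral addrK => <-.
(* An infinite integral has real value 0 by convention, so both sides are 0 in the infinite cases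
   and convergence need not be discussed. *)
move: (integral _ _ _) => [r| |] //=.
- by rewrite mulry gtr0_sg // mul1e mulr0.
- by rewrite mulrNy gtr0_sg // mul1e mulr0.
Qed.

(** * Volumes *)

Lemma continuous_hemisphere (R : realType) (r : R) (k : nat) :
  continuous (fun x : R => Num.sqrt (r ^+ 2 - x ^+ 2) ^+ k).
Proof.
move=> x; apply: (@continuous_comp R R R
  (fun x : R => Num.sqrt (r ^+ 2 - x ^+ 2)) (fun y : R => y ^+ k)).
  apply: (@continuous_comp R R R (fun x : R => r ^+ 2 - x ^+ 2)); last exact: sqrt_continuous.
  by apply: cvgB; [exact: cvg_cst | exact: exprn_continuous].
exact: exprn_continuous.
Qed.

(** The ratio of the volumes of the unit balls of dimensions [k + 1] and [k]. *)
Definition cap_integral (R : realType) (k : nat) : R :=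
  \int[lebesgue_measure]_(x in `[-1, 1]) (Num.sqrt (1 - x ^+ 2) ^+ k).

Lemma integrable_segment (R : realType) (f : R -> R) (a b : R) : continuous f ->
  lebesgue_measure.-integrable `[a, b] (EFin \o f).
Proof.
move=> cf; apply: continuous_compact_integrable; first exact: segment_compact.
exact: continuous_subspaceT.
Qed.

Lemma integral_hemisphere (R : realType) (r : R) (k : nat) : 0 <= r ->
  (\int[lebesgue_measure]_(x in `[(- r)%R, r]) (Num.sqrt (r ^+ 2 - x ^+ 2) ^+ k)%:E =
   (r ^+ k.+1 * cap_integral R k)%:E)%E.
Proof.
rewrite le_eqVlt => /predU1P[<-|r0].
  (* The substitution [x = r y] degenerates for [r = 0], where the interval is a point. *)
  by rewrite oppr0 set_itv1 integral_set1 expr0n mul0r.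
have d (x : R) : is_derive x 1 (fun x : R => r * x) r.
  by apply: is_derive_eq; rewrite /GRing.scale /= mulr1.
have d1 : (fun x : R => r * x)^`()%classic = fun=> r.
  by apply/funext => x; rewrite derive1E derive_val.
have c : continuous (fun x : R => r * x).
  by move=> x; apply: differentiable_continuous; apply/derivable1_diffP; exact: ex_derive.
have -> : `[(- r)%R, r] = `[(r * -1)%R, r * 1] :> interval R by rewrite mulrN !mulr1.
rewrite integration_by_substitution_increasing //.
- rewrite d1 /cap_integral.
  transitivity (\int[lebesgue_measure]_(x in `[(-1)%R, 1%R])
      ((r ^+ k.+1)%:E * (Num.sqrt (1 - x ^+ 2) ^+ k)%:E))%E.
    apply: eq_integral => x _; rewrite /= -EFinM; congr (_%:E).
    rewrite -[LHS]/(Num.sqrt (r ^+ 2 - (r * x) ^+ 2) ^+ k * r).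
    rewrite exprMn -{1}[r ^+ 2]mulr1 -mulrBr sqrtrM ?sqr_ge0 // sqrtr_sqr gtr0_norm //.
    by rewrite exprMn [r ^+ k.+1]exprSr mulrAC.
  have i : lebesgue_measure.-integrable `[(-1)%R, 1%R]
      (EFin \o (fun x : R => Num.sqrt (1 - x ^+ 2) ^+ k)).
    by apply: integrable_segment; have := @continuous_hemisphere R 1 k; rewrite expr1n.
  rewrite integralZl //= EFinM /Rintegral fineK //.
  exact: integrable_fin_num.
- by move=> x y _ _; rewrite ltr_pM2l.
- by rewrite d1 => x _; exact: cvg_cst.
- by rewrite d1; exact: is_cvg_cst.
- by rewrite d1; exact: is_cvg_cst.
- split.
  + by move=> x _; exact: ex_derive.
  + by apply: cvg_at_right_filter; exact: c.
  + by apply: cvg_at_left_filter; exact: c.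
- by apply: continuous_subspaceT; exact: continuous_hemisphere.
Qed.

Lemma cap_integral_even (R : realType) (l : nat) :
  cap_integral R (2 * l) = \int[lebesgue_measure]_(x in `[-1, 1]) ((1 - x ^+ 2) ^+ l).
Proof.
apply: eq_Rintegral => x; rewrite inE /= in_itv /= => /andP[x1 x2].
rewrite exprM sqr_sqrtr //; nra.
Qed.

(* [x (1 - x^2)^(l+1)] vanishes at both end points. *)
Lemma cap_integral_rec (R : realType) (l : nat) :
  (l%:R + 2^-1 + 1) * cap_integral R (2 * l.+1) = l.+1%:R * cap_integral R (2 * l).
Proof.
have cc m : continuous (fun x : R => (1 - x ^+ 2) ^+ m).
  move=> x; apply: (@continuous_comp R R R (fun x : R => 1 - x ^+ 2) (fun y : R => y ^+ m)).
    by apply: cvgB; [exact: cvg_cst | exact: exprn_continuous].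
  exact: exprn_continuous.
(* Writing [x^2 = 1 - (1 - x^2)] in the derivative of this polynomial gives [f]; the factor [2^-1]
   matches the constants of the statement. *)
pose P : {poly R} := 2^-1 *: ('X * (1 - 'X^2) ^+ l.+1).
pose F := horner P.
pose f (x : R) := (l%:R + 2^-1 + 1) * (1 - x ^+ 2) ^+ l.+1 - l.+1%:R * (1 - x ^+ 2) ^+ l.
have cf : continuous f.
  by move=> x; apply: cvgB; apply: cvgMr; exact: cc.
have d (x : R) : is_derive x 1 F (f x).
  have -> : f x = P^`().[x]; last exact: is_derive_poly.
  rewrite /P derivZ derivM derivX deriv_exp derivB derivC derivXn /= /f.
  rewrite !(hornerE, hornerMn, horner_exp, hornerXn) /= exprS.
  by field.
have cF x : {for x, continuous F}.
  by apply: differentiable_continuous; apply/derivable1_diffP; exact: ex_derive.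
have : (\int[lebesgue_measure]_(x in `[(-1)%R, 1%R]) (f x)%:E = 0)%E.
  rewrite (@continuous_FTC2 _ f F).
  - by rewrite /F /P !(hornerE, horner_exp) /= sqrrN expr1n subrr expr0n !mulr0 -EFinB subr0.
  - lra.
  - exact: continuous_subspaceT.
  - split; first by move=> x _; exact: ex_derive.
    + by apply: cvg_at_right_filter; exact: cF.
    + by apply: cvg_at_left_filter; exact: cF.
  - by move=> x _; rewrite derive1E derive_val.
have i m : lebesgue_measure.-integrable `[(-1)%R, 1%R]
    (EFin \o (fun x : R => (1 - x ^+ 2) ^+ m)).
  exact: integrable_segment.
have im (a : R) m : lebesgue_measure.-integrable `[(-1)%R, 1%R]
    (EFin \o (fun x : R => a * (1 - x ^+ 2) ^+ m)).
  by apply: integrable_segment => x; apply: cvgMr; exact: cc.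
move/(congr1 fine); rewrite -/(Rintegral _ _ _) /= RintegralB // !RintegralZl //.
by rewrite -!cap_integral_even => /eqP; rewrite subr_eq0 => /eqP.
Qed.

(** Up to the constant [ball_volume], the volume of an [n]-ball of squared radius [s]. The sign test
    makes the ball empty for [s < 0] also when [n = 0], where the power would be 1. *)
Definition ball_profile (R : realType) (n : nat) (s : R) : R :=
  if 0 <= s then Num.sqrt s ^+ n else 0.

Lemma ball_profile_ge0 (R : realType) (n : nat) (s : R) : 0 <= ball_profile n s.
Proof. by rewrite /ball_profile; case: ifP => // _; rewrite exprn_ge0 ?sqrtr_ge0. Qed.

Lemma measurable_ball_profile (R : realType) (n : nat) :
  measurable_fun setT (@ball_profile R n).
Proof.
apply: measurable_fun_ifT.
- by apply: measurable_fun_ler; [exact: measurable_cst | exact: measurable_id].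
- apply: measurable_funX.
  by apply: continuous_measurable_fun; exact: sqrt_continuous.
- exact: measurable_cst.
Qed.

Lemma integral_ball_profile (R : realType) (n : nat) (s : R) :
  (\int[lebesgue_measure]_x (ball_profile n (s - x ^+ 2))%:E =
   (cap_integral R n * ball_profile n.+1 s)%:E)%E.
Proof.
rewrite {2}/ball_profile; case: (lerP 0 s) => s0; last first.
  rewrite mulr0 integral0_eq // => x _; rewrite /ball_profile ifF //.
  by apply/negbTE; rewrite -ltNge; nra.
rewrite mulrC -integral_hemisphere ?sqrtr_ge0 // [RHS]integral_mkcond.
apply: eq_integral => x _; rewrite patchE mem_setE in_itv /= sqr_sqrtr //.
have -> : (- Num.sqrt s <= x <= Num.sqrt s) = (0 <= s - x ^+ 2).
  rewrite -ler_norml subr_ge0 -[X in _ = (_ <= X)](sqr_sqrtr s0) -[x ^+ 2]real_normK ?num_real //.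
  by rewrite ler_pXn2r ?nnegrE ?sqrtr_ge0.
by rewrite /ball_profile; case: ifP.
Qed.

(** The volume of the unit ball, as a telescoping product of ratios of consecutive dimensions. *)
Definition ball_volume (R : realType) (n : nat) : R := \prod_(k < n) cap_integral R k.

Lemma cap_integral_ge0 (R : realType) (k : nat) : 0 <= cap_integral R k.
Proof. by apply: Rintegral_ge0 => x _; rewrite exprn_ge0 ?sqrtr_ge0. Qed.

Lemma ball_volume_ge0 (R : realType) (n : nat) : 0 <= ball_volume R n.
Proof. by apply: prodr_ge0 => k _; exact: cap_integral_ge0. Qed.

Lemma integral_ball_volume (R : realType) (n : nat) (s : R) :
  (\int[lebesgue_measure]_x (ball_volume R n * ball_profile n (s - x ^+ 2))%:E =
   (ball_volume R n.+1 * ball_profile n.+1 s)%:E)%E.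
Proof.
under eq_integral do rewrite EFinM.
rewrite ge0_integralZl_EFin ?ball_volume_ge0 //.
- by rewrite integral_ball_profile -EFinM /ball_volume big_ord_recr /= mulrA.
- by move=> x _; rewrite lee_fin ball_profile_ge0.
- apply/measurable_EFinP; apply: measurableT_comp; first exact: measurable_ball_profile.
  by apply: measurable_funB; [exact: measurable_cst | exact: measurable_funX].
Qed.

(** * Volumes of bodies of revolution *)

Lemma volumeS (R : realType) (n : nat) (A : set 'rV[R]_n.+1) :
  volume A = (\int[lebesgue_measure]_x
    volume [set v : 'rV[R]_n | A (row_mx (x%:M : 'rV[R]_1) v)])%E.
Proof. by []. Qed.

(** Fixing the first coordinate [x] leaves a region of the same kind with [h - x^2] in place of [h],
    which is why [h] is arbitrary in the induction. Tonelli then moves the axis variable outside. *)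
Lemma volume_of_revolution (R : realType) (n : nat) (h : R -> R) : measurable_fun setT h ->
  volume [set v : 'rV[R]_n.+1 |
    \sum_(i < n) v ord0 (widen_ord (leqnSn n) i) ^+ 2 <= h (v ord0 ord_max)] =
  (\int[lebesgue_measure]_y (ball_volume R n * ball_profile n (h y))%:E)%E.
Proof.
elim: n h => [|n IH] h mh; rewrite volumeS.
  apply: eq_integral => x _; rewrite /ball_volume big_ord0 mul1r /ball_profile expr0.
  rewrite -[LHS]/((\1_[set v : 'rV[R]_0 | \sum_(i < 0) row_mx (x%:M : 'rV_1) v ord0
    (widen_ord (leqnSn 0) i) ^+ 2 <= h (row_mx (x%:M : 'rV_1) v ord0 ord_max)] 0)%:E).
  have -> : [set v : 'rV[R]_0 | \sum_(i < 0) row_mx (x%:M : 'rV_1) v ord0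
      (widen_ord (leqnSn 0) i) ^+ 2 <= h (row_mx (x%:M : 'rV_1) v ord0 ord_max)] =
      [set v | 0 <= h x].
    apply/funext => v /=; rewrite big_ord0.
    have -> : ord_max = lshift 0 (ord0 : 'I_1) by exact: val_inj.
    by rewrite row_mxEl mxE eqxx.
  by rewrite indicE; case: (lerP 0 (h x)) => hx; [rewrite mem_set | rewrite memNset //= leNgt hx].
transitivity (\int[lebesgue_measure]_x \int[lebesgue_measure]_y
    (ball_volume R n * ball_profile n (h y - x ^+ 2))%:E)%E.
  apply: eq_integral => x _; rewrite -IH; last first.
    by apply: measurable_funB => //; exact: measurable_cst.
  congr (volume _); apply/funext => v /=; apply/propext.
  rewrite big_ord_recl.
  have -> : row_mx (x%:M : 'rV_1) v ord0 (widen_ord (leqnSn n.+1) ord0) = x.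
    transitivity (row_mx (x%:M : 'rV_1) v ord0 (lshift n.+1 (ord0 : 'I_1))).
      by congr (row_mx _ _ _ _); exact: val_inj.
    by rewrite row_mxEl mxE eqxx.
  have vr j (i : 'I_n.+2) : i = j.+1 :> nat -> row_mx (x%:M : 'rV_1) v ord0 i = v ord0 (inord j).
    move=> ij; transitivity (row_mx (x%:M : 'rV_1) v ord0 (rshift 1 (inord j : 'I_n.+1))).
      congr (row_mx _ _ _ _); apply: val_inj; rewrite /= ij inordK //.
      by rewrite -ltnS -ij.
    by rewrite row_mxEr.
  rewrite (vr n) //; have -> : inord n = ord_max :> 'I_n.+1.
    by apply: val_inj; rewrite /= inordK.
  rewrite (eq_bigr (fun i : 'I_n => v ord0 (widen_ord (leqnSn n) i) ^+ 2)) => [|i _].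
    by rewrite lerBrDl.
  rewrite (vr i) //; congr (v _ _ ^+ 2); apply: val_inj.
  by rewrite /= inordK // ltnW // ltnS.
rewrite -(@fubini_tonelli _ _ _ _ _ lebesgue_measure lebesgue_measure
  (fun u => (ball_volume R n * ball_profile n (h u.1 - u.2 ^+ 2))%:E)) /=.
- by apply: eq_integral => y _; rewrite integral_ball_volume.
- apply/measurable_EFinP; apply: measurable_funM; first exact: measurable_cst.
  apply: measurableT_comp; first exact: measurable_ball_profile.
  apply: measurable_funB; first exact: measurableT_comp.
  by apply: measurable_funX.
- by move=> u; rewrite lee_fin mulr_ge0 ?ball_volume_ge0 ?ball_profile_ge0.
Qed.

(** * The parallel body of the flat ball *)

Lemma sum_sqr_scale (R : realType) (n : nat) (a : R) (x : 'I_n -> R) :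
  \sum_(i < n) (a * x i) ^+ 2 = a ^+ 2 * \sum_(i < n) x i ^+ 2.
Proof. by rewrite mulr_sumr; apply: eq_bigr => i _; rewrite exprMn. Qed.

(* Convexity of the square with the weights [1 / (1 + s)] and [s / (1 + s)]. *)
Lemma sum_sqr_add_le (R : realType) (n : nat) (x w : 'rV[R]_n) (s : R) : 0 <= s ->
  \sum_(i < n) x ord0 i ^+ 2 <= 1 -> \sum_(i < n) w ord0 i ^+ 2 <= s ^+ 2 ->
  \sum_(i < n) (x ord0 i + w ord0 i) ^+ 2 <= (1 + s) ^+ 2.
Proof.
rewrite le_eqVlt => /predU1P[<-|s0] hx hw.
  rewrite expr0n in hw.
  have w0 i : w ord0 i = 0.
    have /eqP : \sum_(i < n) w ord0 i ^+ 2 = 0.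
      by apply/le_anti; rewrite hw sumr_ge0 // => j _; exact: sqr_ge0.
    rewrite psumr_eq0 => [|j _]; last exact: sqr_ge0.
    by move=> /allP /(_ i); rewrite mem_index_enum sqrf_eq0 => /(_ isT) /eqP.
  by rewrite addr0 expr1n; under eq_bigr do rewrite w0 addr0.
have le i : (x ord0 i + w ord0 i) ^+ 2 <= (1 + s) * (x ord0 i ^+ 2 + s^-1 * w ord0 i ^+ 2).
  rewrite -subr_ge0.
  have -> : (1 + s) * (x ord0 i ^+ 2 + s^-1 * w ord0 i ^+ 2) - (x ord0 i + w ord0 i) ^+ 2 =
      s * (x ord0 i - s^-1 * w ord0 i) ^+ 2 by field; rewrite gt_eqF.
  by rewrite mulr_ge0 ?sqr_ge0 // ltW.
apply: (le_trans (ler_sum _ (fun i _ => le i))).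
rewrite -mulr_sumr big_split /= -mulr_sumr expr2 ler_pM2l; last lra.
have : s^-1 * \sum_(i < n) w ord0 i ^+ 2 <= s by rewrite mulrC ler_pdivrMr // -expr2.
by lra.
Qed.

Lemma eballE (R : realType) (n : nat) (x : 'rV[R]_n) :
  eball R n x = (\sum_(i < n) x ord0 i ^+ 2 <= 1).
Proof. by rewrite /eball /enorm /=; congr is_true; rewrite -[RHS]ler_sqrt // sqrtr1. Qed.

Definition flat_row (R : realType) (n : nat) (x : 'rV[R]_n) : 'rV[R]_n.+1 :=
  castmx (erefl 1%N, addn1 n) (row_mx x (0 : 'rV[R]_1)).

Lemma flat_row_widen (R : realType) (n : nat) (x : 'rV[R]_n) (i : 'I_n) :
  flat_row x ord0 (widen_ord (leqnSn n) i) = x ord0 i.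
Proof.
rewrite castmxE /= -[RHS](row_mxEl x (0 : 'rV_1)).
by congr (row_mx _ _ _ _); exact: val_inj.
Qed.

Lemma flat_row_max (R : realType) (n : nat) (x : 'rV[R]_n) : flat_row x ord0 ord_max = 0.
Proof.
rewrite castmxE /=.
transitivity (row_mx x (0 : 'rV[R]_1) ord0 (rshift n (ord0 : 'I_1))).
  by congr (row_mx _ _ _ _); apply: val_inj; rewrite //= addn0.
by rewrite row_mxEr mxE.
Qed.

(** The squared radius of the section at height [y]; the value -1 encodes an empty section, since no
    sum of squares is at most -1. *)
Definition body_profile (R : realType) (t y : R) : R :=
  if `|y| <= t then (1 + Num.sqrt (t ^+ 2 - y ^+ 2)) ^+ 2 else -1.

(** At height [y] a vector of the ball [t B] has horizontal length at most [sqrt (t^2 - y^2)], which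
    is added to the radius 1. Conversely, a point of the section is reached from the nearest point
    of the unit ball. *)
Lemma parallel_flat_ball (R : realType) (n : nat) (t : R) : 0 < t ->
  parallel_body (flat_ball R n) t =
  [set v : 'rV[R]_n.+1 |
    \sum_(i < n) v ord0 (widen_ord (leqnSn n) i) ^+ 2 <= body_profile t (v ord0 ord_max)].
Proof.
move=> t0; apply/seteqP; split => v /=.
  move=> [_ [x hx <-]] [b hb <-]; rewrite -/(flat_row x); rewrite !eballE in hx hb.
  rewrite !mxE flat_row_max add0r.
  under eq_bigr do rewrite !mxE flat_row_widen.
  rewrite big_ord_recr /= in hb.
  set S := \sum_(i < n) _ in hb.
  have S0 : 0 <= S by apply: sumr_ge0 => i _; exact: sqr_ge0.
  have b1 : b ord0 ord_max ^+ 2 <= 1 by lra.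
  have bt : `|t * b ord0 ord_max| <= t.
    by rewrite normrM gtr0_norm // ler_piMr ?(ltW t0) // -(@expr_le1 _ 2) // real_normK ?num_real.
  rewrite /body_profile bt.
  have h : 0 <= t ^+ 2 - (t * b ord0 ord_max) ^+ 2.
    by rewrite exprMn -{1}[t ^+ 2]mulr1 -mulrBr mulr_ge0 ?sqr_ge0 ?subr_ge0.
  pose w : 'rV[R]_n := \row_i (t * b ord0 (widen_ord (leqnSn n) i)).
  have wE i : w ord0 i = t * b ord0 (widen_ord (leqnSn n) i) by rewrite mxE.
  rewrite (eq_bigr (fun i => (x ord0 i + w ord0 i) ^+ 2)) => [|i _]; last by rewrite wE.
  apply: sum_sqr_add_le => //.
  rewrite sqr_sqrtr // (eq_bigr _ (fun i _ => congr1 (fun y => y ^+ 2) (wE i))) sum_sqr_scale.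
  rewrite exprMn -{2}[t ^+ 2]mulr1 -mulrBr ler_pM2l ?exprn_gt0 //. by rewrite lerBrDr.
rewrite /body_profile; case: ifPn => yt; last first.
  by move=> h; have := le_trans (sumr_ge0 _ (fun i _ => sqr_ge0 _)) h; lra.
set s := Num.sqrt _; set y := v ord0 ord_max in yt s *.
have s0 : 0 <= s := sqrtr_ge0 _.
have sE : s ^+ 2 = t ^+ 2 - y ^+ 2.
  rewrite sqr_sqrtr // subr_ge0 -[y ^+ 2]real_normK ?num_real //.
  by rewrite ler_pXn2r ?nnegrE // ltW.
pose x : 'rV[R]_n := \row_i v ord0 (widen_ord (leqnSn n) i).
have xE i : x ord0 i = v ord0 (widen_ord (leqnSn n) i) by rewrite mxE.
pose r := Num.sqrt (\sum_(i < n) x ord0 i ^+ 2).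
have r2 : r ^+ 2 = \sum_(i < n) x ord0 i ^+ 2.
  by rewrite sqr_sqrtr // sumr_ge0 // => i _; exact: sqr_ge0.
have r0 : 0 <= r := sqrtr_ge0 _.
move=> hv.
have rs : r <= 1 + s.
  rewrite -(@ler_pXn2r _ 2) ?nnegrE ?addr_ge0 // r2.
  by under eq_bigr do rewrite xE.
(* [c *: x] is the point of the unit ball nearest to [x]. *)
pose c := if r <= 1 then 1 else r^-1.
(* The distance [(1 - c) r] is 0 inside the unit ball and [r - 1 <= s] outside. *)
have cr : c * r <= 1 /\ (1 - c) ^+ 2 * r ^+ 2 <= s ^+ 2.
  rewrite /c; case: (lerP r 1) => r1.
    by rewrite mul1r subrr expr0n mul0r sqr_ge0.
  rewrite mulVf ?gt_eqF //; last lra; split=> //.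
  rewrite -exprMn mulrBl mul1r mulVf ?gt_eqF //; last lra.
  by rewrite ler_pXn2r ?nnegrE //; lra.
have c0 : 0 <= c by rewrite /c; case: ifP => // _; rewrite invr_ge0.
exists (flat_row (c *: x)).
  exists (c *: x) => //; rewrite eballE.
  under eq_bigr do rewrite mxE.
  rewrite sum_sqr_scale -r2 -exprMn.
  by apply: exprn_ile1; [exact: mulr_ge0 | case: cr].
exists (t^-1 *: (v - flat_row (c *: x))); last first.
  by rewrite scalerA mulfV ?gt_eqF // scale1r addrC subrK.
rewrite eballE big_ord_recr /=.
under eq_bigr do rewrite !mxE flat_row_widen.
rewrite !mxE flat_row_max subr0 -/y.
have -> : \sum_(i < n) (t^-1 * (v ord0 (widen_ord (leqnSn n) i) - (c *: x) ord0 i)) ^+ 2 =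
    t^-1 ^+ 2 * ((1 - c) ^+ 2 * r ^+ 2).
  rewrite r2 !mulr_sumr; apply: eq_bigr => i _; rewrite !mxE; ring.
rewrite exprMn -mulrDr exprVn mulrC ler_pdivrMr ?exprn_gt0 // mul1r.
by case: cr => _; rewrite sE; lra.
Qed.

Lemma measurable_body_profile (R : realType) (t : R) : measurable_fun setT (body_profile t).
Proof.
apply: measurable_fun_ifT.
- apply: measurable_fun_ler; last exact: measurable_cst.
  exact: normr_measurable.
- apply: measurable_funX; apply: measurable_funD; first exact: measurable_cst.
  have := @continuous_hemisphere R t 1; under eq_fun do rewrite expr1.
  exact: continuous_measurable_fun.
- exact: measurable_cst.
Qed.

(** * The Steiner polynomial of the flat ball *)

Definition flat_ball_steiner (R : realType) (n : nat) : {poly R} :=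
  \sum_(k < n.+1) (ball_volume R n * 'C(n, k)%:R * cap_integral R k) *: 'X^(k.+1).

(** Expand [(1 + sqrt (t^2 - y^2))^n] by the binomial theorem; the [k]-th term integrates to a
    multiple of [t^(k+1)]. *)
Lemma volume_parallel_flat_ball (R : realType) (n : nat) (t : R) : 0 < t ->
  volume (parallel_body (flat_ball R n) t) = ((flat_ball_steiner R n).[t])%:E.
Proof.
move=> t0; rewrite parallel_flat_ball // volume_of_revolution; last exact: measurable_body_profile.
transitivity (\int[lebesgue_measure]_(y in `[(- t)%R, t]) \sum_(k < n.+1)
    ((ball_volume R n * 'C(n, k)%:R)%:E * (Num.sqrt (t ^+ 2 - y ^+ 2) ^+ k)%:E))%E.
  rewrite [RHS]integral_mkcond; apply: eq_integral => y _.
  rewrite patchE mem_setE in_itv /= -ler_norml /ball_profile /body_profile.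
  case: (boolP (`|y| <= t)) => yt; last by rewrite (lt_geF (ltrN10 R)) mulr0.
  rewrite sqr_ge0 sqrtr_sqr ger0_norm ?addr_ge0 ?sqrtr_ge0 //.
  under [RHS]eq_bigr do rewrite -EFinM.
  rewrite sumEFin; congr (_%:E).
  rewrite addrC exprD1n mulr_sumr; apply: eq_bigr => k _.
  by rewrite -mulr_natr mulrA mulrAC.
have mh k : measurable_fun (`[(- t)%R, t] : set R) (fun y => (Num.sqrt (t ^+ 2 - y ^+ 2) ^+ k)%:E).
  apply/measurable_EFinP; apply: measurable_funTS; apply: continuous_measurable_fun.
  exact: continuous_hemisphere.
rewrite ge0_integral_sum //; last 2 first.
- by move=> k; apply: emeasurable_funM; [exact: measurable_cst | exact: mh].
- by move=> k y _; rewrite -EFinM lee_fin !mulr_ge0 ?ball_volume_ge0 ?exprn_ge0 ?sqrtr_ge0.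
rewrite /flat_ball_steiner horner_sum -sumEFin; apply: eq_bigr => k _.
rewrite ge0_integralZl_EFin ?mulr_ge0 ?ball_volume_ge0 //.
- by rewrite integral_hemisphere ?ltW // -EFinM hornerZ hornerXn -!mulrA [t ^+ _ * _]mulrC.
- exact: mh.
Qed.

(** A nonzero difference would vanish at 1, 2, ..., up to its size, which exceeds its degree. *)
Lemma poly_eq_pos (R : realType) (P Q : {poly R}) :
  (forall t : R, 0 < t -> P.[t] = Q.[t]) -> P = Q.
Proof.
move=> h; apply/eqP; rewrite -subr_eq0; apply/negPn/negP => PQ0.
pose rs : seq R := [seq i.+1%:R | i <- iota 0 (size (P - Q))].
have root_rs : all (root (P - Q)) rs.
  apply/allP => _ /mapP[i _ ->].
  by rewrite /root hornerD hornerN h ?subrr // ltr0n.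
have uniq_rs : uniq rs.
  by rewrite map_inj_uniq ?iota_uniq // => i j /eqP; rewrite eqr_nat eqSS => /eqP.
by have := max_poly_roots PQ0 root_rs uniq_rs; rewrite size_map size_iota ltnn.
Qed.

Lemma steiner_flat_ball (R : realType) (n : nat) :
  exists a : R, steiner_poly (flat_ball R n) = a *: flat_ball_steiner R n.
Proof.
(* The multiple is 1 when [xget] finds a polynomial and 0 when it returns its default. *)
rewrite /steiner_poly; case: xgetP => [S _ [_ hS]|_]; last by exists 0; rewrite scale0r.
exists 1; rewrite scale1r; apply: poly_eq_pos => t t0.
by have := hS t (ltW t0); rewrite volume_parallel_flat_ball // => -[].
Qed.

Lemma coef_flat_ball_steiner (R : realType) (n l : nat) :
  (flat_ball_steiner R n)`_l.+1 = ball_volume R n * 'C(n, l)%:R * cap_integral R l.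
Proof.
rewrite coef_sum; under eq_bigr do rewrite coefZ coefXn eqSS.
have [ln|nl] := ltnP l n.+1.
  rewrite (bigD1 (Ordinal ln)) //= eqxx mulr1 big1 ?addr0 // => k kl.
  by rewrite -(inj_eq val_inj) /= eq_sym in kl; rewrite (negbTE kl) mulr0.
rewrite bin_small // mulr0 mul0r big1 // => k _.
by rewrite gtn_eqF ?mulr0 // (leq_trans (ltn_ord k)).
Qed.

(** * Reduction of the Weyl polynomial to the ball polynomial *)

Lemma Gamma_prod (R : realType) (x : R) (l : nat) : 1 < x ->
  Gamma (x + l%:R) = Gamma x * \prod_(i < l) (x + i%:R).
Proof.
move=> x1; elim: l => [|l IH]; first by rewrite big_ord0 addr0 mulr1.
rewrite big_ord_recr /= mulrA -IH -natr1 addrA Gamma_rec 1?mulrC //.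
by rewrite ltr_wpDr.
Qed.

(** The product is the Gamma quotient in [weyl_coef]; it cancels against the integral and leaves the
    factorial in the numerator of [weyl_ratio]. *)
Lemma cap_integral_prod (R : realType) (l : nat) :
  \prod_(i < l) (2^-1 + 1 + i%:R) * cap_integral R (2 * l) =
  l`!%:R * cap_integral R 0.
Proof.
elim: l => [|l IH]; first by rewrite big_ord0 muln0.
rewrite big_ord_recr /= -mulrA.
have -> : 2^-1 + 1 + l%:R = l%:R + 2^-1 + 1 :> R by ring.
by rewrite cap_integral_rec mulrCA IH factS natrM mulrA.
Qed.

Lemma weyl_ratio_prod (R : realType) (p l : nat) :
  weyl_ratio R p l = l`!%:R / \prod_(i < l) (p%:R / 2 + 1 + i%:R).
Proof.
rewrite /weyl_ratio prodf_div; congr (_ / _).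
elim: l => [|l IH]; first by rewrite big_ord0.
by rewrite big_ord_recr /= IH factS natrM mulrC.
Qed.

Lemma weyl_flat_ball (R : realType) (p n : nat) : (0 < p)%N ->
  exists c : R, weyl_poly p (flat_ball R n) = c *: (weyl_ball R p n \Po 'X^2).
Proof.
move=> p0; have [a aE] := steiner_flat_ball R n.
pose G : R := Gamma (p%:R / 2 + 1); pose g : R := Gamma (2^-1 + 1).
(* The quotients [G / G] and [g / g] stay unsimplified, so the identity holds whether or not these
   Gamma values vanish. *)
exists (a * ball_volume R n * cap_integral R 0 * (G / G) * (g / g)).
rewrite /weyl_poly /weyl_ball raddf_sum scaler_sumr; apply: eq_bigr => l _ /=.
rewrite comp_polyZ comp_Xn_poly -exprM scalerA; congr (_ *: _).
rewrite /weyl_coef aE coefZ addn1 coef_flat_ball_steiner weyl_ratio_prod.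
have p1 : 1 < p%:R / 2 + 1 :> R by rewrite ltrDr divr_gt0 // ltr0n.
have h1 : 1 < 2^-1 + 1 :> R by rewrite ltrDr invr_gt0.
have -> : p%:~R / 2 + l%:R + 1 = p%:R / 2 + 1 + l%:R :> R by rewrite addrAC.
have -> : l%:R + 2^-1 + 1 = 2^-1 + 1 + l%:R :> R by rewrite -addrA addrC.
rewrite !Gamma_prod // -/g -[Gamma (p%:~R / 2 + 1)]/G -/G invfM.
have two : 2 ^- l * 2 ^+ l = 1 :> R by rewrite mulVf // expf_neq0.
transitivity ((2 ^- l * 2 ^+ l) * (G / G) * (g / g) * a * ball_volume R n * 'C(n, 2 * l)%:R /
  \prod_(i < l) (p%:R / 2 + 1 + i%:R) *
  (\prod_(i < l) (2^-1 + 1 + i%:R) * cap_integral R (2 * l))).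
  by ring.
by rewrite two cap_integral_prod; ring.
Qed.

Theorem theorem2p11 (R : realType) (p : int) (hp : 5 <= p) :
  exists N : nat, forall n : nat, (N <= n)%N ->
    ~ conservative (weyl_poly p (flat_ball R n)) /\
    exists z : R[i],
      root (complex_poly (weyl_poly p (flat_ball R n))) z /\
      complex.Re z <> 0.
Proof.
case: p hp => p p5; last by [].
have [N hN] := @weyl_ball_not_neg_rooted R p p5.
exists N => n /hN nr.
have p0 : (0 < p)%N by exact: leq_trans p5.
have [c cE] := weyl_flat_ball R n p0.
have [z rz zR] := weyl_ball_nonreal_root cE nr.
split; last by exists z.
by move=> /(_ z rz) [].
Qed.
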